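(* Let $A$ be an integral domain and $M$ a torsion-free $A$-module. The following are equivalent. (i) $M$ is a PS module. (ii) If $a,b\in A-\{0\}$, $y\in M-\{0\}$ and $a\mid by$, then $a=cd$ for some $c,d\in A$ with $c\mid b$ and $d\mid y$. (iii) If $b\in A-\{0\}$, $x,y\in M-\{0\}$ and $x\mid by$, then $x=az$ for some $a\in A$, $z\in M$ with $a\mid b$ and $z\mid y$. (iv) If $a\in A-\{0\}$ and $x,y,z\in M-\{0\}$ are such that each of $a,x$ divides each of $y,z$, then there is some $u\in M$ such that each of $a,x$ divides $u$ and $u$ divides each of $y,z$. (v) $aM\cap Ax$ is a locally cyclic $A$-module for all $a\in A-\{0\}$, $x\in M-\{0\}$. (vi) $(aM:x)$ is a locally cyclic ideal of $A$ for all $a\in A-\{0\}$, $x\in M-\{0\}$.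
   Context: All rings are commutative and unitary. Let $A$ be an integral domain and $M$ a torsion-free $A$-module. If $y=ax$ with $a\in A-\{0\}$ and $x,y\in M-\{0\}$, then both the scalar $a$ and the vector $x$ are called divisors of $y$; so for a scalar $a$, $a\mid y$ means $y\in aM$, and for a vector $x\in M$, $x\mid y$ means $y\in Ax$. Divisibility between scalars is the usual one in $A$. $M$ is a PS module (pre-Schreier module) if every equality $ax=by$ with $a,b\in A-\{0\}$ and $x,y\in M-\{0\}$ has a refinement, i.e. there exist $c,d,e\in A$ and $z\in M$ with $a=ce$, $b=cd$, $x=dz$, $y=ez$. An $A$-module is locally cyclic if each of its finitely generated submodules is contained in a cyclic submodule (of it). For $a\in A$, $x\in M$, $(aM:x)=\{b\in A : bx\in aM\}$. *)

(* Defs.v *)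
From HB Require Import structures.
From mathcomp Require Import all_boot all_order all_algebra.
Set Implicit Arguments.
Unset Strict Implicit.
Unset Printing Implicit Defensive.
Import GRing.Theory.
Local Open Scope ring_scope.

(* Subsets are Prop-valued predicates, so no membership test is assumed
   decidable. *)

Section Modules.
Variables (A : idomainType) (M : lmodType A).

Definition torsion_free : Prop :=
  forall (a : A) (x : M), a *: x = 0 -> a = 0 \/ x = 0.

Definition scalar_dvd (a b : A) : Prop := exists c : A, b = c * a.

Definition multiples (a : A) (y : M) : Prop := exists x : M, y = a *: x.

Definition cyclic_span (x : M) (y : M) : Prop := exists a : A, y = a *: x.

(* On nonzero vectors of a torsion-free module the scalar (resp. vector)
   witness in the two relations below is automatically nonzero. *)
Definition scalar_dvd_vec (a : A) (y : M) : Prop := multiples a y.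

Definition vec_dvd_vec (x y : M) : Prop := cyclic_span x y.

Definition PS_module : Prop :=
  forall (a b : A) (x y : M),
    a <> 0 -> b <> 0 -> x <> 0 -> y <> 0 -> a *: x = b *: y ->
    exists (c d e : A) (z : M),
      [/\ a = c * e, b = c * d, x = d *: z & y = e *: z].

Definition is_submodule (N : M -> Prop) : Prop :=
  [/\ N 0, forall u v, N u -> N v -> N (u + v)
    & forall (a : A) u, N u -> N (a *: u)].

Definition fin_span (s : seq M) (v : M) : Prop :=
  exists c : 'I_(size s) -> A, v = \sum_i c i *: s`_i.

Definition subset_of (N P : M -> Prop) : Prop := forall v, N v -> P v.

Definition finitely_generated (N : M -> Prop) : Prop :=
  exists s : seq M, forall v, N v <-> fin_span s v.

Definition cyclic_submodule (N : M -> Prop) : Prop :=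
  exists x : M, forall v, N v <-> cyclic_span x v.

(* N is meant to be a submodule of M; it is viewed as a module in its own
   right, so the cyclic submodule C has to lie inside N. *)
Definition locally_cyclic (N : M -> Prop) : Prop :=
  forall F : M -> Prop,
    is_submodule F -> subset_of F N -> finitely_generated F ->
    exists C : M -> Prop,
      [/\ is_submodule C, subset_of C N, cyclic_submodule C & subset_of F C].

Definition multiples_cap_cyclic (a : A) (x : M) (y : M) : Prop :=
  multiples a y /\ cyclic_span x y.

(* The ideal (aM : x), typed as a subset of the regular module A^o. *)
Definition colon_ideal (a : A) (x : M) (b : A^o) : Prop :=
  multiples a ((b : A) *: x).

Fact multiples_cap_cyclic_submodule a x :
  is_submodule (multiples_cap_cyclic a x).
Proof.
split.
- by split; exists 0; rewrite ?scaler0 ?scale0r.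
- move=> _ _ [[u ->] [b eb]] [[v ->] [c ec]]; split.
    by exists (u + v); rewrite scalerDr.
  by exists (b + c); rewrite scalerDl eb ec.
- move=> k _ [[u ->] [b eb]]; split.
    by exists (k *: u); rewrite !scalerA mulrC.
  by exists (k * b); rewrite eb scalerA.
Qed.

End Modules.

Fact colon_ideal_submodule (A : idomainType) (M : lmodType A) a (x : M) :
  is_submodule (colon_ideal a x).
Proof.
split.
- by exists 0; rewrite scaler0 scale0r.
- move=> b c [u eu] [v ev]; exists (u + v).
  by rewrite scalerDl scalerDr eu ev.
- move=> k b [u eu]; exists (k *: u).
  by rewrite -scalerA eu !scalerA mulrC.
Qed.

Arguments torsion_free {A} M.
Arguments PS_module {A} M.

(* Main.v *)
Require Import Defs.
From HB Require Import structures.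
From mathcomp Require Import all_boot all_order all_algebra.
Import GRing.Theory.
Local Open Scope ring_scope.

(** Local cyclicity of a submodule [N] amounts to any two elements of [N] having
    a common divisor inside [N], so (iv) is (v) up to zero vectors, and
    [b |-> b *: x] carries [(aM : x)] isomorphically onto [aM :&: Ax], so (v)
    gives (vi).  Given [a *: x = b *: y], a common divisor [c] of [a] and [b] in
    [(aM : y)] is the first entry of a refinement, so (vi) gives (i).  The step
    from (iii) to (iv) applies (iii) twice, once for each of the two vectors. *)

Section LocallyCyclic.
Set Implicit Arguments.
Unset Strict Implicit.
Variables (A : idomainType) (M : lmodType A).
Implicit Types (u v w : M) (s : seq M) (N : M -> Prop).

Lemma fin_span_mem s i : (i < size s)%N -> fin_span s s`_i.
Proof.
move=> lt_is; exists (fun j => (j == Ordinal lt_is)%:R).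
rewrite (bigD1 (Ordinal lt_is)) //= eqxx scale1r big1 ?addr0 // => j /negPf ->.
by rewrite scale0r.
Qed.

Lemma fin_span_submodule_sub s N :
  is_submodule N -> (forall i, (i < size s)%N -> N s`_i) ->
  subset_of (fin_span s) N.
Proof.
move=> [N0 ND NZ] sN _ [c ->]; elim/big_ind: _ => // i _.
exact/NZ/sN/ltn_ord.
Qed.

Lemma cyclic_span_submodule u : is_submodule (cyclic_span u).
Proof.
split; first by exists 0; rewrite scale0r.
- by move=> _ _ [a ->] [b ->]; exists (a + b); rewrite scalerDl.
- by move=> a _ [b ->]; exists (a * b); rewrite scalerA.
Qed.

Lemma fin_span_submodule s : is_submodule (fin_span s).
Proof.
split; first by exists (fun=> 0); rewrite big1 // => i _; rewrite scale0r.
- move=> _ _ [c ->] [d ->]; exists (fun i => c i + d i).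
  by rewrite -big_split; apply: eq_bigr => i _; rewrite scalerDl.
- move=> a _ [c ->]; exists (fun i => a * c i).
  by rewrite scaler_sumr; apply: eq_bigr => i _; rewrite scalerA.
Qed.

Lemma vec_dvd_vec_refl u : vec_dvd_vec u u.
Proof. by exists 1; rewrite scale1r. Qed.

Lemma vec_dvd_vec_trans u v w :
  vec_dvd_vec u v -> vec_dvd_vec v w -> vec_dvd_vec u w.
Proof. by move=> [a ->] [b ->]; exists (b * a); rewrite scalerA. Qed.

Lemma vec_dvd_vec0 u : vec_dvd_vec u 0.
Proof. by exists 0; rewrite scale0r. Qed.

(** Fold the binary property along the list: a common divisor of the head and of a divisor of the
    whole tail divides every entry by transitivity. The empty list uses [0] as the member of [N]. *)
Lemma common_divisor_seq N s :
    N 0 ->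
    (forall u v, N u -> N v ->
       exists w, [/\ N w, vec_dvd_vec w u & vec_dvd_vec w v]) ->
    (forall i, (i < size s)%N -> N s`_i) ->
  exists2 w, N w & forall i, (i < size s)%N -> vec_dvd_vec w s`_i.
Proof.
move=> N0 cdN; elim: s => [|v s IHs] sN; first by exists 0.
have [w Nw ws] := IHs (fun i => sN i.+1).
have [w' [Nw' w'v w'w]] := cdN _ _ (sN 0 isT) Nw.
exists w' => // -[|i] lt_is //=.
exact/(vec_dvd_vec_trans w'w)/ws.
Qed.

(** A generator of a cyclic submodule of [N] containing the span of [u] and [v] is their common
    divisor. Conversely, a common divisor in [N] of a finite generating list spans the required
    cyclic submodule, which stays in [N] by closure under scaling. *)
Lemma locally_cyclicP N : is_submodule N ->
  locally_cyclic N <->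
  forall u v, N u -> N v ->
    exists w, [/\ N w, vec_dvd_vec w u & vec_dvd_vec w v].
Proof.
move=> subN; have [N0 _ NZ] := subN; split=> [lcN u v Nu Nv | cdN F _ FN [s Fs]].
  have [||C [_ CN [w Cw] sC]] := lcN _ (fin_span_submodule [:: u; v]).
  - by apply: fin_span_submodule_sub => // -[|[|]].
  - by exists [:: u; v].
  exists w; split; first by apply/CN/Cw/vec_dvd_vec_refl.
  - by apply/Cw/sC; apply: (@fin_span_mem [:: u; v] 0).
  - by apply/Cw/sC; apply: (@fin_span_mem [:: u; v] 1).
have [|w Nw ws] := @common_divisor_seq N s N0 cdN.
  by move=> i lt_is; apply/FN/Fs/fin_span_mem.
exists (cyclic_span w); split.
- exact: cyclic_span_submodule.
- by move=> _ [a ->]; apply: NZ.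
- by exists w.
- move=> v /Fs.
  exact: fin_span_submodule_sub (cyclic_span_submodule w) ws v.
Qed.

End LocallyCyclic.

Section NonzeroFactors.
Set Implicit Arguments.
Unset Strict Implicit.
Variables (A : idomainType) (M : lmodType A).

Lemma scaler_neq0_l (a : A) (x : M) :
  a *: x <> 0 -> a <> 0.
Proof. by move=> ax0 a0; rewrite a0 scale0r in ax0. Qed.

Lemma scaler_neq0_r (a : A) (x : M) :
  a *: x <> 0 -> x <> 0.
Proof. by move=> ax0 x0; rewrite x0 scaler0 in ax0. Qed.

Lemma mulr_neq0_l (a b : A) : a * b <> 0 -> a <> 0.
Proof. by move=> ab0 a0; rewrite a0 mul0r in ab0. Qed.

Lemma mulr_neq0_r (a b : A) : a * b <> 0 -> b <> 0.
Proof. by move=> ab0 b0; rewrite b0 mulr0 in ab0. Qed.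

End NonzeroFactors.

Section TorsionFree.
Variables (A : idomainType) (M : lmodType A).
Hypothesis tfM : torsion_free M.

Lemma torsion_free_scaler_neq0 (a : A) (x : M) : a <> 0 -> x <> 0 -> a *: x <> 0.
Proof. by move=> a0 x0 /tfM[]. Qed.

Lemma torsion_free_scaler_injl (a : A) (x y : M) :
  a <> 0 -> a *: x = a *: y -> x = y.
Proof.
move=> a0 /eqP; rewrite -subr_eq0 -scalerBr => /eqP /tfM[] // /eqP.
by rewrite subr_eq0 => /eqP.
Qed.

Lemma torsion_free_scaler_injr (a b : A) (x : M) :
  x <> 0 -> a *: x = b *: x -> a = b.
Proof.
move=> x0 /eqP; rewrite -subr_eq0 -scalerBl => /eqP /tfM[] // /eqP.
by rewrite subr_eq0 => /eqP.
Qed.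

End TorsionFree.

Theorem theorem2p7 (A : idomainType) (M : lmodType A)
    (M_torsion_free : torsion_free M) :
  [<-> PS_module M;
       forall (a b : A) (y : M), a <> 0 -> b <> 0 -> y <> 0 ->
         scalar_dvd_vec a (b *: y) ->
         exists c d : A, [/\ a = c * d, scalar_dvd c b & scalar_dvd_vec d y];
       forall (b : A) (x y : M), b <> 0 -> x <> 0 -> y <> 0 ->
         vec_dvd_vec x (b *: y) ->
         exists (a : A) (z : M),
           [/\ x = a *: z, scalar_dvd a b & vec_dvd_vec z y];
       forall (a : A) (x y z : M), a <> 0 -> x <> 0 -> y <> 0 -> z <> 0 ->
         scalar_dvd_vec a y -> scalar_dvd_vec a z ->
         vec_dvd_vec x y -> vec_dvd_vec x z ->
         exists u : M,
           [/\ scalar_dvd_vec a u, vec_dvd_vec x u,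
               vec_dvd_vec u y & vec_dvd_vec u z];
       forall (a : A) (x : M), a <> 0 -> x <> 0 ->
         locally_cyclic (multiples_cap_cyclic a x);
       forall (a : A) (x : M), a <> 0 -> x <> 0 ->
         locally_cyclic (colon_ideal a x)].
Proof.
have neq0 := torsion_free_scaler_neq0 M_torsion_free.
have injl := torsion_free_scaler_injl M_torsion_free.
have injr := torsion_free_scaler_injr M_torsion_free.
tfae.
- move=> PS a b y a0 b0 y0 [x byE].
  have x0 : x <> 0 by apply: (@scaler_neq0_r _ _ a); rewrite -byE; apply: neq0.
  (* In the refinement, [c] is shared by [a] and [b], and the cofactor [e] of [a] is the scalar
     dividing [y]. *)
  have [c [d [e [z [-> -> _ ->]]]]] := PS a b x y a0 b0 x0 y0 (esym byE).
  by exists c, e; split; [|exists d; rewrite mulrC|exists z].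
- move=> ii b x y b0 x0 y0 [a byE].
  have a0 : a <> 0 by apply: (@scaler_neq0_l _ _ _ x); rewrite -byE; apply: neq0.
  have [|c [d [aE [b' bE] [y' yE]]]] := ii a b y a0 b0 y0; first by exists x.
  (* The cofactors do the job: [a *: x = b *: y = (b' * c * d) *: y' = a *: (b' *: y')], and [a]
     cancels. *)
  exists b', y'; split; [|by exists c; rewrite bE mulrC|by exists d].
  by apply: (injl a) => //; rewrite -byE bE yE aE !scalerA -mulrA mulrC.
- move=> iii a x y z a0 x0 y0 z0 [y' yE'] [z' zE'] xy [t azE].
  subst y z.
  have [c [w [xE [a' aE] [f yE]]]] := iii a x y' a0 x0 (scaler_neq0_r y0) xy.
  rewrite aE in a0; have [a'0 c0] := (mulr_neq0_l a0, mulr_neq0_r a0).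
  rewrite xE in x0.
  (* Cancelling [c] from [a *: z' = t *: x], where [a = a' * c] and [x = c *: w], shows that [w]
     divides [a' *: z'], so (iii) applies again. *)
  have [|g [v [wE [h a'E] [k zE]]]] :=
      iii a' w z' a'0 (scaler_neq0_r x0) (scaler_neq0_r z0).
    exists t; apply: (injl c) => //.
    by rewrite !scalerA mulrC -aE azE xE scalerA mulrC.
  (* Now [v] divides both [y'] and [z'], while [x = (c * g) *: v] with [c * g] dividing [a]. *)
  exists (a *: v); split; first by exists v.
  + by exists h; rewrite xE wE aE a'E !scalerA mulrAC.
  + by exists (f * g); rewrite yE wE !scalerA -mulrA mulrC.
  + by exists k; rewrite zE !scalerA mulrC.
- move=> iv a x a0 x0; apply/locally_cyclicP.
    exact: multiples_cap_cyclic_submodule.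
  (* Everything divides [0], so if one vector vanishes the other is a common divisor. *)
  move=> u v Nu Nv; have [u0|/eqP u0] := eqVneq u 0.
    by exists v; split=> //; [rewrite u0; apply: vec_dvd_vec0|apply: vec_dvd_vec_refl].
  have [v0|/eqP v0] := eqVneq v 0.
    by exists u; split=> //; [apply: vec_dvd_vec_refl|rewrite v0; apply: vec_dvd_vec0].
  have [[au xu] [av xv]] := (Nu, Nv).
  by have [w [aw xw wu wv]] := iv a x u v a0 x0 u0 v0 au av xu xv; exists w.
- move=> v a x a0 x0; apply/locally_cyclicP; first exact: colon_ideal_submodule.
  move=> b c ab ac.
  have subN := multiples_cap_cyclic_submodule a x.
  have cd := (locally_cyclicP subN).1 (v a x a0 x0).
  have [||w [[aw [d wE]] [k bE] [l cE]]] := cd (b *: x) (c *: x).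
  + by split=> //; exists b.
  + by split=> //; exists c.
  (* The common divisor is [d *: x] and lies in [aM], so [d] is in the colon ideal; cancelling [x]
     turns vector divisibility into scalar divisibility. *)
  subst w; exists d; split=> //.
  + by exists k; apply: (injr _ _ x) => //; rewrite bE scalerA.
  + by exists l; apply: (injr _ _ x) => //; rewrite cE scalerA.
- move=> vi a b x y a0 b0 x0 y0 axE.
  have subI := colon_ideal_submodule a y.
  have cd := (locally_cyclicP subI).1 (vi a y a0 y0).
  (* Both scalars lie in [(aM : y)]: [a] trivially, and [b] because [b *: y = a *: x]. *)
  have [||c [[z cyE] [e aE] [d bE]]] := cd a b.
  + by exists y.
  + by exists x.
  (* Scaling in the regular module is multiplication in [A]. *)
  rewrite /GRing.scale /= in aE bE.
  have c0 : c <> 0 by apply: (@mulr_neq0_r _ e); rewrite -aE.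
  (* Membership of [c] in the ideal gives [c *: y = a *: z = (e * c) *: z]. *)
  have yE : y = e *: z.
    by apply: (injl c) => //; rewrite cyE aE scalerA mulrC.
  exists c, d, e, z; split=> //; rewrite 1?[c * _]mulrC //.
  apply: (injl a) => //.
  by rewrite axE bE yE aE !scalerA mulrC [d * c]mulrC mulrA.
Qed.
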